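(* Every true combinatorial proposition has a combinatorial proof.
   Context: A graph $(V,E)$: finite $V$, $E$ a set of two-element subsets of $V$; write $vw$. A homomorphism $h:G\to G'$ satisfies $vw\in E(G)\Rightarrow h(v)h(w)\in E(G')$; it is a skew fibration if for every $v\in V(G)$ and every $w$ with $h(v)w\in E(G')$ there is $\hat w$ with $v\hat w\in E(G)$ and $h(\hat w)w\notin E(G')$. A cograph is a graph with nonempty vertex set such that for distinct $v,w,x,y$ the edges among $\{v,w,x,y\}$ are not exactly $\{vw,wx,xy\}$. Atoms: literals $p,\overline p$ (variables $p$) and constants $0,1$; $p,\overline p$ dual. A combinatorial proposition is a cograph with an atom label on each vertex. A stable set contains no edge; a clause is a maximal stable set; a clause is true if it contains a $1$-labelled vertex or two vertices labelled by dual literals; a labelled graph is true if all its clauses are true. A coloured graph has an equivalence relation $\sim$ on $V$ with $v\sim w$, $v\ne w$ implying $vw\notin E$; classes are colour classes. $W$ induces a matching if $W\ne\emptyset$ and each $w\in W$ has a unique $w'\in W$ with $ww'\in E$. Nicely coloured: every colour class has at most two vertices and no union of two-vertex colour classes induces a matching. A combinatorial proof of a combinatorial proposition $P$ is a skew fibration $h:C\to P$ from a nicely coloured cograph $C$ whose colour classes are axiomatic: a class $\{v\}$ with $h(v)$ labelled $1$, or a class $\{v,w\}$ with $h(v),h(w)$ labelled by dual literals. *)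

(* Defs.v *)
From mathcomp Require Import all_boot.

Set Implicit Arguments.
Unset Strict Implicit.
Unset Printing Implicit Defensive.

(* The edge set is encoded by its adjacency relation: a set of two-element
   subsets of the vertices is the same as a symmetric irreflexive relation. *)
Record graph := Graph {
  vertex :> finType;
  edge : rel vertex;
  edge_sym : symmetric edge;
  edge_irr : irreflexive edge
}.

Arguments edge {g} _ _.

Definition homomorphism (G G' : graph) (h : G -> G') : Prop :=
  forall v w : G, edge v w -> edge (h v) (h w).

Definition skew_fibration (G G' : graph) (h : G -> G') : Prop :=
  homomorphism h /\
  forall (v : G) (w : G'), edge (h v) w ->
    exists w' : G, edge v w' /\ ~~ edge (h w') w.

Definition cograph (G : graph) : Prop :=
  0 < #|G| /\
  forall v w x y : G, uniq [:: v; w; x; y] ->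
    ~ [&& edge v w, edge w x, edge x y,
          ~~ edge v x, ~~ edge v y & ~~ edge w y].

Inductive atom (X : Type) : Type :=
  | Pos of X
  | Neg of X
  | Zero
  | One.

Arguments Zero {X}.
Arguments One {X}.

(* The constants are not literals, so they are not dual here. *)
Definition dual_literals (X : Type) (a b : atom X) : Prop :=
  exists p : X, (a = Pos p /\ b = Neg p) \/ (a = Neg p /\ b = Pos p).

Record labelled_graph (X : Type) := LabelledGraph {
  underlying :> graph;
  label : underlying -> atom X
}.

Arguments label {X l} _.

Record combinatorial_proposition (X : Type) := CombinatorialProposition {
  proposition_graph :> labelled_graph X;
  proposition_cograph : cograph proposition_graph
}.

Definition stable (G : graph) (S : {set G}) : bool :=
  [forall v in S, forall w in S, ~~ edge v w].

Definition clause (G : graph) (S : {set G}) : bool := maxset (@stable G) S.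

Definition true_clause (X : Type) (G : labelled_graph X) (S : {set G}) : Prop :=
  (exists2 v : G, v \in S & label v = One) \/
  (exists v w : G, [/\ v \in S, w \in S & dual_literals (label v) (label w)]).

Definition true_graph (X : Type) (G : labelled_graph X) : Prop :=
  forall S : {set G}, clause S -> true_clause S.

Record coloured_graph := ColouredGraph {
  uncoloured :> graph;
  same_colour : rel uncoloured;
  same_colour_equiv : equivalence_rel same_colour;
  same_colour_edge :
    forall v w : uncoloured, same_colour v w -> v != w -> ~~ edge v w
}.

Arguments same_colour {c} _ _.

Definition colour_classes (C : coloured_graph) : {set {set C}} :=
  equivalence_partition (@same_colour C) [set: C].

Definition induces_matching (G : graph) (W : {set G}) : Prop :=
  W != set0 /\
  forall w : G, w \in W -> exists! w' : G, w' \in W /\ edge w w'.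

Definition nicely_coloured (C : coloured_graph) : Prop :=
  (forall K : {set C}, K \in colour_classes C -> #|K| <= 2) /\
  (forall F : {set {set C}}, F \subset colour_classes C ->
     (forall K : {set C}, K \in F -> #|K| = 2) ->
     ~ induces_matching (cover F)).

Definition axiomatic (X : Type) (C : coloured_graph) (P : labelled_graph X)
    (h : C -> P) (K : {set C}) : Prop :=
  (exists2 v : C, K = [set v] & label (h v) = One) \/
  (exists2 vw : C * C, K = [set vw.1; vw.2] &
     dual_literals (label (h vw.1)) (label (h vw.2))).

Definition combinatorial_proof (X : Type) (P : combinatorial_proposition X)
    (C : coloured_graph) (h : C -> P) : Prop :=
  [/\ cograph C, nicely_coloured C, skew_fibration h &
      forall K : {set C}, K \in colour_classes C -> axiomatic h K].

(* Main.v *)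
(** Induction on an induced subgraph [U] of [P], in the manner of the sequent
    calculus.  If [U] has no edge it is a single clause, and a vertex labelled
    [One] or a pair of dual vertices is already a proof.  Otherwise [U] is the
    disjoint union of some [D] and a join of nonempty [A] and [B]; every clause
    of [D :|: A] or of [D :|: B] is a clause of [U], so both have proofs [C1]
    and [C2].  If [C1] misses [A], or [C2] misses [B], it proves [U];
    otherwise [U] is proved by the disjoint union of [C1] and [C2] with all
    edges added between the preimages of [A] and of [B]. *)
Require Import Defs.
From mathcomp Require Import all_boot.

Set Implicit Arguments.
Unset Strict Implicit.
Unset Printing Implicit Defensive.

(** * Induced paths and maximal joins *)

(* No distinctness is required: the pattern of edges forces it. *)
Definition P4_free (G : graph) : Prop :=
  forall v w x y : G,
    ~~ [&& edge v w, edge w x, edge x y,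
           ~~ edge v x, ~~ edge v y & ~~ edge w y].

Lemma edge_neq (G : graph) (v w : G) : edge v w -> v != w.
Proof. by apply: contraTneq => ->; rewrite edge_irr. Qed.

Lemma cographP (G : graph) : cograph G <-> 0 < #|G| /\ P4_free G.
Proof.
split=> [] [G0 H]; split=> //; last first.
  by move=> v w x y _; apply/negP/H.
move=> v w x y; apply/negP => p4; apply: (H v w x y) (p4).
case/and5P: p4 => vw wx xy vx /andP [vy wy].
have vnx : v != x by apply: contraNneq vy => ->.
have vny : v != y by apply: contraNneq vx => ->; rewrite edge_sym.
have wny : w != y by apply: contraNneq vy => <-.
by rewrite /= !inE !negb_or (edge_neq vw) (edge_neq wx) (edge_neq xy) vnx vny wny.
Qed.

Definition joined (G : graph) (A B : {set G}) : bool :=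
  [forall a in A, forall b in B, edge a b].

Lemma joinedP (G : graph) (A B : {set G}) :
  reflect {in A & B, forall a b, edge a b} (joined A B).
Proof.
apply: (iffP forall_inP) => [H a b aA bB|H a aA]; first exact: (forall_inP (H a aA)).
by apply/forall_inP => b bB; apply: H.
Qed.

Lemma joinedC (G : graph) (A B : {set G}) : joined A B = joined B A.
Proof.
by apply/joinedP/joinedP => H a b aA bB; rewrite edge_sym; apply: H.
Qed.

Lemma joined_disjoint (G : graph) (A B : {set G}) :
  joined A B -> [disjoint A & B].
Proof.
move=> /joinedP AB; apply/pred0P => x /=; apply/negP => /andP [xA xB].
by have := AB x x xA xB; rewrite edge_irr.
Qed.

(* If [x] is adjacent to part [A1] of [A], then [A1] is joined to everything
   else, including [x], which yields a larger join. *)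
Lemma joined_grow (G : graph) (U A B : {set G}) (x a : G) :
  P4_free G -> A \subset U -> B \subset U -> A != set0 -> B != set0 ->
  joined A B -> x \in U -> x \notin A :|: B -> a \in A -> edge x a ->
  exists A' B' : {set G},
    [/\ A' \subset U, B' \subset U, A' != set0, B' != set0 &
        joined A' B' /\ #|A| + #|B| < #|A'| + #|B'|].
Proof.
move=> p4 AU BU A0 B0 jAB xU; rewrite inE negb_or => /andP [xA xB] aA xa.
have AB := joinedP _ _ jAB.
(* If [x] is adjacent to all of one side, it can be added to the other side. *)
have [xjA|/forall_inPn [a2 a2A xa2]] := boolP [forall c in A, edge x c].
  exists A, (x |: B); split=> //.
  - by rewrite subUset sub1set xU.
  - by apply/set0Pn; exists x; rewrite setU11.
  split; last by rewrite cardsU1 xB add1n addnS.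
  apply/joinedP => c b cA; rewrite !inE => /predU1P [->|bB]; last exact: AB.
  by rewrite edge_sym; apply: (forall_inP xjA).
have [xjB|/forall_inPn [b bB xb]] := boolP [forall c in B, edge x c].
  exists (x |: A), B; split=> //.
  - by rewrite subUset sub1set xU.
  - by apply/set0Pn; exists x; rewrite setU11.
  split; last by rewrite cardsU1 xA add1n addSn.
  apply/joinedP => c b; rewrite !inE => /predU1P [->|cA] bB; last exact: AB.
  exact: (forall_inP xjB).
pose A1 := [set c in A | edge x c].
have A1A : A1 \subset A by apply/subsetP => c; rewrite inE => /andP [].
have dAB := joined_disjoint jAB.
exists A1, (x |: (A :\: A1) :|: B); split.
- exact: subset_trans A1A AU.
- rewrite !subUset sub1set xU BU /= andbT.
  exact: subset_trans (subsetDl _ _) AU.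
- by apply/set0Pn; exists a; rewrite inE aA.
- by apply/set0Pn; exists x; rewrite !inE eqxx.
split.
  apply/joinedP => c d; rewrite inE => /andP [cA xc].
  rewrite !inE => /orP [/predU1P [->|]|dB]; last exact: AB.
    by rewrite edge_sym.
  rewrite andbC => /andP [dA]; rewrite dA /= => xd.
  (* Were [c] and [d] not adjacent, [x], [c], [b], [d] would be an induced path: [b] is adjacent to
     [c] and [d] but not to [x]. *)
  have := p4 x c b d.
  rewrite xc (AB c b cA bB) (edge_sym b d) (AB d b dA bB) (negbTE xb) (negbTE xd) /=.
  by rewrite negbK.
have dis : [disjoint x |: (A :\: A1) & B].
  rewrite disjoint_sym disjoints_subset setCU subsetI subsetC sub1set inE xB /=.
  by rewrite -disjoints_subset disjoint_sym; apply: disjointWl dAB; apply: subsetDl.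
move: dis; rewrite -(leq_card_setU _ _).2 => /eqP ->.
rewrite cardsU1 !inE (negbTE xA) /= cardsDS //.
by rewrite addnA addnCA subnKC ?subset_leq_card.
Qed.

(** The edge [vw] is already a join; among the joins in [U], one with the most vertices cannot have
    an outside neighbour in [U], by [joined_grow]. *)
Lemma P4_free_join (G : graph) (U : {set G}) (v w : G) :
  P4_free G -> v \in U -> w \in U -> edge v w ->
  exists A B : {set G},
    [/\ A \subset U, B \subset U, A != set0, B != set0 & joined A B /\
        forall x c, x \in U -> x \notin A :|: B -> c \in A :|: B -> ~~ edge x c].
Proof.
move=> p4 vU wU vw.
pose good (AB : {set G} * {set G}) :=
  [&& AB.1 \subset U, AB.2 \subset U, AB.1 != set0, AB.2 != set0 & joined AB.1 AB.2].
have good0 : good ([set v], [set w]).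
  rewrite /good /= !sub1set vU wU /=; apply/and3P; split.
  - by apply/set0Pn; exists v; rewrite set11.
  - by apply/set0Pn; exists w; rewrite set11.
  - by apply/joinedP => a b /set1P -> /set1P ->.
case: (arg_maxnP (fun AB : {set G} * {set G} => #|AB.1| + #|AB.2|) good0) => -[A B] /= gAB maxAB.
case/and5P: gAB => /= AU BU A0 B0 jAB.
exists A, B; split=> //; split=> // x c xU xAB /setUP cAB; apply/negP => xc.
have [A' [B' [? ? ? ? [? ltAB]]]] : exists A' B' : {set G},
    [/\ A' \subset U, B' \subset U, A' != set0, B' != set0 &
        joined A' B' /\ #|A| + #|B| < #|A'| + #|B'|].
  case: cAB => cAB; first exact: (joined_grow (x := x) (a := c) p4 AU BU).
  rewrite addnC; apply: (joined_grow (x := x) (a := c) p4 BU AU) => //.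
  - by rewrite joinedC.
  - by rewrite setUC.
move: ltAB; rewrite ltnNge => /negP; apply; apply: (maxAB (A', B')).
exact/and5P.
Qed.

(** * Parity of matched sets *)

(** Removing a vertex and its partner leaves a smaller matched set: by uniqueness, no other vertex
    has either of the two as partner. *)
Lemma matched_even (T : finType) (r : rel T) (S : {set T}) :
  symmetric r -> irreflexive r ->
  (forall x, x \in S -> exists! y, y \in S /\ r x y) -> ~~ odd #|S|.
Proof.
move=> rS rI; move: {2}#|S| (leqnn #|S|) => n.
elim: n S => [|n IH] S leS H; first by move: leS; rewrite leqn0 => /eqP ->.
have [->|[x xS]] := set_0Vmem S; first by rewrite cards0.
have [y [[yS xy] uy]] := H x xS.
have ynx : y != x by apply: contraTneq xy => ->; rewrite rI.
have yS' : y \in S :\ x by rewrite !inE ynx.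
have [u [[uS yu] uu]] := H y yS.
have eS : #|S| = #|S :\ x :\ y|.+2 by rewrite (cardsD1 x S) xS (cardsD1 y (S :\ x)) yS'.
rewrite eS /= negbK; apply: IH.
  by move: leS; rewrite eS => /ltnW.
move=> z; rewrite !inE => /and3P [zy zx zS].
have [t [[tS zt] ut]] := H z zS.
exists t; split=> [|t' [+ zt']]; last first.
  by rewrite !inE => /and3P [_ _ t'S]; apply: ut.
split=> //; rewrite !inE tS andbT; apply/andP; split.
- apply: contraNneq zx => ty; rewrite -(uu x) ?(rS y x) //.
  by rewrite -(uu z) // rS -ty.
- apply: contraNneq zy => tx; rewrite -(uy z) // rS -tx //.
Qed.

(** * Proofs over an induced subgraph *)

(* A colouring with classes of at most two vertices is encoded by the
   involution [t] whose orbits are the classes. *)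
Record subproof (X : Type) (P : labelled_graph X) (U : {set P})
    (C : graph) (t : C -> C) (h : C -> P) : Prop := Subproof {
  sp_nonempty : 0 < #|C|;
  sp_P4_free : P4_free C;
  sp_invol : involutive t;
  sp_edge : forall v, ~~ edge v (t v);
  sp_nice : forall W : {set C},
    (forall v, v \in W -> t v \in W /\ t v != v) -> ~ induces_matching W;
  sp_in : forall v, h v \in U;
  sp_hom : homomorphism h;
  sp_skew : forall v w, w \in U -> edge (h v) w ->
    exists w', edge v w' /\ ~~ edge (h w') w;
  sp_axiomatic : forall v,
    (t v = v /\ label (h v) = One) \/
    dual_literals (label (h v)) (label (h (t v)))
}.

Definition provable (X : Type) (P : labelled_graph X) (U : {set P}) : Prop :=
  exists (C : graph) (t : C -> C) (h : C -> P), subproof U t h.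

(** The sets [S] are the clauses of the subgraph induced on [U]; maximality is expressed by
    domination. *)
Definition true_on (X : Type) (P : labelled_graph X) (U : {set P}) : Prop :=
  forall S : {set P}, S \subset U -> stable S ->
    (forall x, x \in U -> x \notin S -> exists2 y, y \in S & edge x y) ->
    true_clause S.

Lemma stableP (G : graph) (S : {set G}) :
  reflect {in S &, forall v w, ~~ edge v w} (stable S).
Proof.
apply: (iffP forall_inP) => [H a b aA bB|H a aA]; first exact: (forall_inP (H a aA)).
by apply/forall_inP => b bB; apply: H.
Qed.

Lemma true_on_setT (X : Type) (P : labelled_graph X) :
  true_graph P -> true_on [set: P].
Proof.
move=> TP S _ stS maxS; apply: TP; apply/maxsetP; split=> // S' stS' SS'.
apply/eqP; rewrite eqEsubset SS' andbT; apply/subsetP => x xS'.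
apply/negPn/negP => xS; have [//|y yS xy] := maxS x _ xS.
by have := stableP _ stS' x y xS' (subsetP SS' _ yS); rewrite xy.
Qed.

Definition edgeless (T : finType) : graph :=
  @Graph T (fun _ _ => false) (fun _ _ => erefl) (fun _ => erefl).

Lemma edgeless_matching (T : finType) (W : {set edgeless T}) :
  ~ induces_matching W.
Proof. by case=> /set0Pn [w wW] /(_ w wW) [w' [[]]]. Qed.

(** The only clause is [U] itself. Its witness of truth gives an edgeless proof with one colour
    class, and the skew condition is vacuous because [U] has no edge. *)
Lemma provable_stable (X : Type) (P : labelled_graph X) (U : {set P}) :
  stable U -> true_on U -> provable U.
Proof.
move=> /[dup] stU /stableP stU' /(_ U (subxx _) stU).
case=> [x -> //|[v vU lv]|[v [w [vU wU dvw]]]].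
- exists (edgeless unit), id, (fun=> v); split=> //.
  + by rewrite card_unit.
  + by move=> W _; apply: edgeless_matching.
  + by move=> v0 w wU vw; have := stU' v w vU wU; rewrite vw.
  + by left.
- exists (edgeless bool), negb, (fun b => if b then v else w); split=> //.
  + by rewrite card_bool.
  + exact: negbK.
  + by move=> W _; apply: edgeless_matching.
  + by case.
  + by move=> b u uU; rewrite (negbTE (stU' _ u _ uU)) //; case: b.
  + case; right=> //=; case: dvw => p dvw; exists p; tauto.
Qed.

(** * Partial joins of two graphs *)

Section Join.

Variables (C1 C2 : graph) (a1 : pred C1) (a2 : pred C2).

Definition join_edge (x y : C1 + C2) : bool :=
  match x, y with
  | inl x, inl y => edge x y
  | inr x, inr y => edge x y
  | inl x, inr y => a1 x && a2 y
  | inr x, inl y => a1 y && a2 x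
  end.

Lemma join_edge_sym : symmetric join_edge.
Proof. by move=> [x|x] [y|y] //=; rewrite edge_sym. Qed.

Lemma join_edge_irr : irreflexive join_edge.
Proof. by move=> [x|x] /=; rewrite edge_irr. Qed.

Definition partial_join : graph := Graph join_edge_sym join_edge_irr.

(** The marked vertices of each side form a union of connected components. *)
Hypothesis a1E : forall v w : C1, edge v w -> a1 v = a1 w.
Hypothesis a2E : forall v w : C2, edge v w -> a2 v = a2 w.

(** A path that meets both sides uses a cross edge, so all its vertices are marked and all its cross
    pairs are edges. An induced path on four vertices has a connected complement, so some cross pair
    would be missing. *)
Lemma partial_join_P4_free : P4_free C1 -> P4_free C2 -> P4_free partial_join.
Proof.
move=> p1 p2 v w x y; apply/negP => /and5P [+ + + + /andP []].
case: v w x y => [v|v] [w|w] [x|x] [y|y] /= vw wx xy nvx nvy nwy;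
  try by have := p1 v w x y; rewrite vw wx xy nvx nvy nwy.
all: try by have := p2 v w x y; rewrite vw wx xy nvx nvy nwy.
all: repeat match goal with
  | H : is_true (@edge C1 _ _) |- _ => apply a1E in H
  | H : is_true (@edge C2 _ _) |- _ => apply a2E in H
  end.
all: move: vw wx xy nvx nvy nwy.
all: by repeat match goal with
  | |- context [a1 ?v] => case: (a1 v) => //
  | |- context [a2 ?v] => case: (a2 v) => //
  end.
Qed.

Variables (t1 : C1 -> C1) (t2 : C2 -> C2).

Definition sum_map (x : C1 + C2) : C1 + C2 :=
  match x with inl x => inl (t1 x) | inr x => inr (t2 x) end.

Hypothesis t1K : involutive t1.

Lemma sum_map_invol : involutive t2 -> involutive sum_map.
Proof. by move=> t2K [x|x] /=; rewrite ?t1K ?t2K. Qed.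

(* If the matching used an edge [xy] between [a1] and [a2], that edge would be
   the only one, so the rest of the [C1]-part, being matched within [C1],
   would be even; but the whole [C1]-part is even, as [t1] pairs it. *)
Lemma matching_no_cross (W : {set partial_join}) (x : C1) (y : C2) :
  (forall v, v \in W -> sum_map v \in W /\ sum_map v != v) ->
  induces_matching W -> inl x \in W -> inr y \in W -> a1 x -> a2 y -> False.
Proof.
move=> tW [_ mW] xW yW a1x a2y.
pose W1 := [set z : C1 | (inl z : partial_join) \in W].
(* Every marked vertex of [W1] is adjacent to [y], whose partner is unique. *)
have uniqx z : z \in W1 -> a1 z -> z = x.
  rewrite inE => zW a1z; have [u [_ uu]] := mW _ yW.
  have e1 : u = inl x by apply: uu; rewrite /= a1x.
  have e2 : u = inl z by apply: uu; rewrite /= a1z.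
  by move: e1; rewrite e2 => -[].
have evW1 : ~~ odd #|W1|.
  apply: (@matched_even _ (fun u v => (v == t1 u) && (u != v))).
  - by move=> u v /=; rewrite eq_sym (inv_eq t1K) (eq_sym u v) eq_sym.
  - by move=> u /=; rewrite eqxx andbF.
  - move=> u; rewrite inE => uW; have [/= tuW tu] := tW _ uW.
    exists (t1 u); split=> [|v [_ /andP [/eqP -> _]] //].
    split; first by rewrite inE.
    by rewrite eqxx eq_sym.
have xW1 : x \in W1 by rewrite inE.
suff : ~~ odd #|W1 :\ x| by move: evW1; rewrite (cardsD1 x W1) xW1 /= negbK => ->.
apply: (@matched_even _ (@edge C1)); [exact: edge_sym|exact: edge_irr|].
move=> z; rewrite !inE => /andP [zx zW].
(* Being unmarked, [z] has its partner in [C1], and that partner is not the marked [x]. *)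
have na1z : ~~ a1 z by apply: contraNN zx => a1z; rewrite (uniqx z) ?inE.
have [u [[uW zu] uu]] := mW _ zW.
case: u uW zu uu => [u|u] uW /= zu uu; last by rewrite (negbTE na1z) in zu.
exists u; split=> [|u' []].
  split=> //; rewrite !inE uW andbT; apply: contraNneq na1z => ux.
  by rewrite (a1E zu) ux.
by rewrite !inE => /andP [_ u'W] zu'; have [] : inl u = inl u' :> C1 + C2 by apply: uu.
Qed.

(** Without cross edges inside [W], the matching restricts to any side that [W] meets, where it is
    excluded. *)
Lemma partial_join_nice (W : {set partial_join}) :
  (forall W1 : {set C1}, (forall v, v \in W1 -> t1 v \in W1 /\ t1 v != v) ->
     ~ induces_matching W1) ->
  (forall W2 : {set C2}, (forall v, v \in W2 -> t2 v \in W2 /\ t2 v != v) ->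
     ~ induces_matching W2) ->
  (forall v, v \in W -> sum_map v \in W /\ sum_map v != v) ->
  ~ induces_matching W.
Proof.
move=> n1 n2 tW /[dup] mW' [W0 mW].
have nox x y : inl x \in W -> inr y \in W -> a1 x && a2 y -> False.
  by move=> xW yW /andP []; apply: matching_no_cross mW' xW yW.
case/set0Pn: W0 => -[x|x] xW.
- apply: (n1 [set z | (inl z : partial_join) \in W]).
    by move=> v; rewrite !inE => /tW /= [-> tv]; split.
  split; first by apply/set0Pn; exists x; rewrite inE.
  move=> z; rewrite inE => zW; have [[u|u] [[uW zu] uu]] := mW _ zW; last first.
    by case: (nox _ _ zW uW).
  exists u; split=> [|u' []]; rewrite inE // => u'W zu'.
  by have [] : inl u = inl u' :> C1 + C2 by apply: uu.
- apply: (n2 [set z | (inr z : partial_join) \in W]).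
    by move=> v; rewrite !inE => /tW /= [-> tv]; split.
  split; first by apply/set0Pn; exists x; rewrite inE.
  move=> z; rewrite inE => zW; have [[u|u] [[uW zu] uu]] := mW _ zW.
    by case: (nox _ _ uW zW).
  exists u; split=> [|u' []]; rewrite inE // => u'W zu'.
  by have [] : inr u = inr u' :> C1 + C2 by apply: uu.
Qed.

End Join.

(** * Combining two subproofs *)

Section Combine.

Variables (X : Type) (P : labelled_graph X) (D A B : {set P}).
Hypothesis DAB : forall x c, x \in D -> c \in A :|: B -> ~~ edge x c.

Lemma DAB_notin c x : c \in A :|: B -> edge c x -> x \notin D.
Proof. by move=> cA; apply: contraTN => xD; rewrite edge_sym DAB. Qed.

(** All images lie in [D], which has no edge to [B], so enlarging the target creates no new skew
    condition. *)
Lemma subproof_weaken (C : graph) (t : C -> C) (h : C -> P) :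
  subproof (D :|: A) t h -> (forall v, h v \notin A) ->
  subproof (D :|: A :|: B) t h.
Proof.
case=> ? ? ? ? ? hin ? skew ? hA; split=> //.
  by move=> v; rewrite inE hin.
move=> v w; rewrite -setUA => /setUP wU vw; apply: skew => //.
have hD : h v \in D by have := hin v; rewrite inE (negbTE (hA v)) orbF.
case: wU => [wD|wAB]; first by rewrite inE wD.
by have := DAB hD wAB; rewrite vw.
Qed.

(** This makes the preimage of [A] a union of components, as the partial join requires. *)
Lemma preimage_edge (C : graph) (t : C -> C) (h : C -> P) (v w : C) :
  subproof (D :|: A) t h -> edge v w -> (h v \in A) = (h w \in A).
Proof.
move=> sp; wlog suff H : v w / edge v w -> h v \in A -> h w \in A.
  by move=> vw; apply/idP/idP; apply: H; rewrite // edge_sym.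
move=> vw vA; have := sp_in sp w; rewrite inE (negbTE (DAB_notin _ (sp_hom sp vw))) //.
by rewrite inE vA.
Qed.

End Combine.

(** Either [v] itself serves, or its skew lift does, which stays over [A] because it is adjacent to
    [v]. It supplies the skew witnesses across the join. *)
Lemma subproof_hit (X : Type) (P : labelled_graph X) (D A B : {set P})
    (C : graph) (t : C -> C) (h : C -> P) (v : C) (w : P) :
  (forall x c, x \in D -> c \in A :|: B -> ~~ edge x c) ->
  subproof (D :|: A) t h -> h v \in A -> w \in A ->
  exists2 w', h w' \in A & ~~ edge (h w') w.
Proof.
move=> DAB sp vA wA; have [vw|] := boolP (edge (h v) w); last by exists v.
have [|w' [vw' w'w]] := sp_skew sp _ vw; first by rewrite inE wA orbT.
by exists w' => //; rewrite -(preimage_edge DAB sp vw').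
Qed.

Lemma subproof_join (X : Type) (P : labelled_graph X) (D A B : {set P})
    (C1 C2 : graph) (t1 : C1 -> C1) (t2 : C2 -> C2) (h1 : C1 -> P) (h2 : C2 -> P)
    (v1 : C1) (v2 : C2) :
  joined A B ->
  (forall x c, x \in D -> c \in A :|: B -> ~~ edge x c) ->
  subproof (D :|: A) t1 h1 -> subproof (D :|: B) t2 h2 ->
  h1 v1 \in A -> h2 v2 \in B -> provable (D :|: A :|: B).
Proof.
move=> /joinedP AB DAB sp1 sp2 v1A v2B.
have DBA x c : x \in D -> c \in B :|: A -> ~~ edge x c by rewrite setUC; apply: DAB.
pose a1 := [pred v | h1 v \in A]; pose a2 := [pred v | h2 v \in B].
have a1E v w : edge v w -> a1 v = a1 w by apply: (preimage_edge DAB sp1).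
have a2E v w : edge v w -> a2 v = a2 w by apply: (preimage_edge DBA sp2).
pose h (v : partial_join a1 a2) := match v with inl v => h1 v | inr v => h2 v end.
exists (partial_join a1 a2), (sum_map t1 t2), h; split.
- by apply/card_gt0P; exists (inl v1).
- exact: partial_join_P4_free (sp_P4_free sp1) (sp_P4_free sp2).
- exact: sum_map_invol (sp_invol sp1) (sp_invol sp2).
- by case=> v; [apply: (sp_edge sp1)|apply: (sp_edge sp2)].
- move=> W; apply: partial_join_nice => //; [exact: (sp_invol sp1)|exact: (sp_nice sp1)|].
  exact: (sp_nice sp2).
- case=> v /=; first by rewrite inE (sp_in sp1).
  by rewrite setUAC inE (sp_in sp2).
- case=> [v|v] [w|w] /=; [exact: (sp_hom sp1)| | |exact: (sp_hom sp2)].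
    by case/andP; apply: AB.
  by case/andP=> wA vB; rewrite edge_sym AB.
- case=> [v|v] w /= wU vw.
  + have [wDA|wDA] := boolP (w \in D :|: A).
      by have [w' ?] := sp_skew sp1 wDA vw; exists (inl w').
    have wB : w \in B by move: wU; rewrite inE (negbTE wDA).
    (* A vertex over [D] has no edge to [B]. Hence [v] lies over [A] and is adjacent to everything
       over [B] in [C2], where a witness is sought. *)
    have vA : h1 v \in A.
      have := sp_in sp1 v; rewrite inE => /orP [vD|//].
      by have := DAB _ w vD; rewrite vw inE wB orbT => /(_ isT).
    have [w' w'B w'w] := subproof_hit DBA sp2 v2B wB.
    by exists (inr w'); rewrite /= vA w'B.
  + have [wDB|wDB] := boolP (w \in D :|: B).
      by have [w' ?] := sp_skew sp2 wDB vw; exists (inr w').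
    have wA : w \in A by move: wU; rewrite setUAC inE (negbTE wDB).
    have vB : h2 v \in B.
      have := sp_in sp2 v; rewrite inE => /orP [vD|//].
      by have := DAB _ w vD; rewrite vw inE wA => /(_ isT).
    have [w' w'A w'w] := subproof_hit DAB sp1 v1A wA.
    by exists (inl w'); rewrite /= vB w'A.
- case=> v /=.
  + by case: (sp_axiomatic sp1 v) => [[-> ->]|]; [left|right].
  + by case: (sp_axiomatic sp2 v) => [[-> ->]|]; [left|right].
Qed.

(** * Truth of the parts and the induction *)

(** A clause of [D :|: A] meets the nonempty [A], since [D] cannot dominate a vertex of [A]; a
    vertex of [A] in it then dominates all of [B]. *)
Lemma true_on_part (X : Type) (P : labelled_graph X) (D A B : {set P}) :
  A != set0 -> joined A B ->
  (forall x c, x \in D -> c \in A :|: B -> ~~ edge x c) ->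
  true_on (D :|: A :|: B) -> true_on (D :|: A).
Proof.
move=> /set0Pn [a aA] /joinedP AB DAB tU S SDA stS maxS.
apply: tU => //; first exact: subset_trans SDA (subsetUl _ _).
move=> x /setUP [xDA|xB] xS; first exact: maxS.
suff [y yS yA] : exists2 y, y \in S & y \in A by exists y => //; rewrite edge_sym AB.
have [aS|aS] := boolP (a \in S); first by exists a.
have [|y yS ay] := maxS a _ aS; first by rewrite inE aA orbT.
exists y => //; have := subsetP SDA _ yS.
by rewrite inE (negbTE (DAB_notin DAB _ ay)) // inE aA.
Qed.

Lemma true_on_provable (X : Type) (P : labelled_graph X) (U : {set P}) :
  P4_free P -> true_on U -> provable U.
Proof.
move=> p4; move: {2}#|U| (leqnn #|U|) => n.
elim: n U => [|n IH] U leU tU.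
  move: leU; rewrite leqn0 cards_eq0 => /eqP U0; apply: provable_stable => //.
  by apply/stableP => v w; rewrite U0 inE.
have [stU|] := boolP (stable U); first exact: provable_stable.
case/forall_inPn => v vU /forall_inPn [w wU]; rewrite negbK => vw.
have [A [B [AU BU A0 B0 [jAB UAB]]]] := P4_free_join p4 vU wU vw.
pose D := U :\: (A :|: B).
have ABU : A :|: B \subset U by rewrite subUset AU.
have eU : U = D :|: A :|: B.
  by rewrite -setUA setUC -{1}(setID U (A :|: B)) (setIidPr ABU).
have DAB x c : x \in D -> c \in A :|: B -> ~~ edge x c.
  by rewrite inE => /andP [xAB xU]; apply: UAB.
have DBA x c : x \in D -> c \in B :|: A -> ~~ edge x c by rewrite setUC; apply: DAB.
have eU' : U = D :|: B :|: A by rewrite setUAC.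
have jBA : joined B A by rewrite joinedC.
(* The removed side is nonempty and disjoint from what remains, so the induction hypothesis
   applies. *)
have smaller E F : U = D :|: E :|: F -> joined E F -> F != set0 ->
    F \subset A :|: B -> #|D :|: E| <= n.
  move=> UEF /joined_disjoint dEF /set0Pn [f fF] FAB.
  rewrite -ltnS; apply: leq_trans leU; apply: proper_card.
  apply/properP; split; first by rewrite UEF subsetUl.
  exists f; first by rewrite UEF inE fF orbT.
  by rewrite !inE -in_setU (subsetP FAB) //= (disjointFl dEF).
have [C1 [t1 [h1 sp1]]] : provable (D :|: A).
  apply: IH; first by apply: (smaller A B) => //; apply: subsetUr.
  by apply: (@true_on_part _ _ _ _ B) => //; rewrite -eU.
have [C2 [t2 [h2 sp2]]] : provable (D :|: B).
  apply: IH; first by apply: (smaller B A) => //; apply: subsetUl.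
  by apply: (@true_on_part _ _ _ _ A) => //; rewrite -eU'.
have [v1 v1A|no1] := pickP [pred v | h1 v \in A]; last first.
  exists C1, t1, h1; rewrite eU; apply: subproof_weaken => // u.
  by have /= -> := no1 u.
have [v2 v2B|no2] := pickP [pred v | h2 v \in B]; last first.
  exists C2, t2, h2; rewrite eU'; apply: subproof_weaken => // u.
  by have /= -> := no2 u.
by rewrite eU; apply: subproof_join sp1 sp2 v1A v2B.
Qed.

(** * Colourings by the orbits of an involution *)

Section OrbitColouring.

Variables (C : graph) (t : C -> C).
Hypothesis tK : involutive t.
Hypothesis t_edge : forall v, ~~ edge v (t v).

Definition orbit_colour (v w : C) : bool := (w == v) || (w == t v).

Lemma orbit_colour_equiv : equivalence_rel orbit_colour.
Proof.
move=> x y z; split=> [|/orP [/eqP -> //|/eqP ->]]; rewrite /orbit_colour ?eqxx //.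
by rewrite tK orbC.
Qed.

Lemma orbit_colour_edge (v w : C) : orbit_colour v w -> v != w -> ~~ edge v w.
Proof. by case/orP => /eqP ->; rewrite ?eqxx. Qed.

Definition orbit_coloured : coloured_graph :=
  ColouredGraph orbit_colour_equiv orbit_colour_edge.

Lemma orbit_coloured_class (K : {set C}) :
  K \in colour_classes orbit_coloured -> exists x, K = [set x; t x].
Proof.
by case/imsetP => x _ ->; exists x; apply/setP => y; rewrite !inE.
Qed.

(** A union of two-vertex orbits is closed under [t] and contains no fixed point. *)
Lemma orbit_coloured_nice :
  (forall W : {set C}, (forall v, v \in W -> t v \in W /\ t v != v) ->
     ~ induces_matching W) ->
  nicely_coloured orbit_coloured.
Proof.
move=> nice; split=> [K /orbit_coloured_class [x ->]|F FC F2].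
  by rewrite cards2; case: (_ != _).
apply: nice => v /bigcupP [K KF vK].
have [x eK] := orbit_coloured_class (subsetP FC _ KF).
have xtx : x != t x by have := F2 _ KF; rewrite eK cards2; case: (x != t x).
suff [tvK tv] : t v \in K /\ t v != v by split=> //; apply/bigcupP; exists K.
by move: vK; rewrite eK => /set2P [] ->; rewrite ?tK !inE eqxx ?orbT // eq_sym.
Qed.

End OrbitColouring.

Theorem theorem4 (X : Type) (P : combinatorial_proposition X) :
  true_graph P ->
  exists (C : coloured_graph) (h : C -> P), combinatorial_proof h.
Proof.
move=> tP; have [_ p4] := (cographP P).1 (proposition_cograph P).
have [C [t [h sp]]] := true_on_provable p4 (true_on_setT tP).
exists (orbit_coloured (sp_invol sp) (sp_edge sp)), h; split.
- by apply/cographP; split; [exact: (sp_nonempty sp)|exact: (sp_P4_free sp)].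
- exact: orbit_coloured_nice (sp_nice sp).
- by split; [exact: (sp_hom sp)|move=> v w; apply: (sp_skew sp); rewrite inE].
- move=> K /orbit_coloured_class [x ->].
  case: (sp_axiomatic sp x) => [[tx lx]|dx]; last by right; exists (x, t x).
  by left; exists x; rewrite // tx setUid.
Qed.
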